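(* Let $n\in\mathbb{N}$ and $S_n=\{(x,k)\in\mathbb{Z}_{\ge 0}^2 : F_n(x,k)>0\}$. Then $$|S_n|=\binom{n+2}{2}-\sum_{i=0}^{n}\left\lfloor \frac{n}{i+1}\right\rfloor .$$
   Context: For integers $n,x,k\ge 0$, $B_n^{x,k}$ denotes the set of binary strings of length $n$ that contain exactly $x$ zeros and in which the longest block of consecutive zeros has length exactly $k$ (so the all-ones string lies in $B_n^{0,0}$). $F_n(x,k)=|B_n^{x,k}|$. *)

(* Defs.v *)
From mathcomp Require Import all_boot all_order all_algebra finmap.
From mathcomp Require Import boolp classical_sets cardinality.
Set Implicit Arguments.
Unset Strict Implicit.
Unset Printing Implicit Defensive.

(* A binary string is a sequence of booleans; [false] is the digit 0. *)

Definition longest_zero_block (w : seq bool) : nat :=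
  \max_(k < (size w).+1 | infix (nseq k false) w) k.

Definition B (n x k : nat) : {set n.-tuple bool} :=
  [set w : n.-tuple bool | (count_mem false w == x)
                         & (longest_zero_block w == k)]%SET.

Definition F (n x k : nat) : nat := #|B n x k|.

Definition S_ (n : nat) : set (nat * nat) :=
  [set p : nat * nat | (0 < F n p.1 p.2)%N]%classic.

(* Main.v *)
Require Import Defs.
From mathcomp Require Import all_boot all_order all_algebra finmap.
From mathcomp Require Import boolp classical_sets cardinality.
From mathcomp Require Import zify.

(** A string with [x] zeros has [n - x] ones, which separate [n - x + 1]
    (possibly empty) blocks of zeros.  Hence [(x, k)] is realised iff
    [k <= x <= n] and [x <= k * (n - x + 1)]: necessity is a count by blocks,
    and a string realising [(x, k)] starts with a full block of [k] zeros and
    fills the later blocks greedily.  The second condition is equivalent to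
    [n %/ (n - x + 1) <= k], so a given [x] admits [x + 1 - n %/ (n - x + 1)]
    values of [k]; sum over [x] and reverse the order of summation. *)

Lemma prefix_nseq_run a j w :
  prefix (nseq a false) (nseq j false ++ true :: w) = (a <= j).
Proof. by elim: a j => [|a IH] [|j] //=; rewrite ?eqxx ?IH. Qed.

Lemma infix_nseq_run a j w :
  infix (nseq a.+1 false) (nseq j false ++ true :: w)
  = (a < j) || infix (nseq a.+1 false) w.
Proof.
elim: j => [|j IH]; first by rewrite cat0s.
rewrite -[LHS]/(prefix (nseq a.+1 false) (nseq j.+1 false ++ true :: w)
  || infix (nseq a.+1 false) (nseq j false ++ true :: w)).
by rewrite IH prefix_nseq_run orbA; congr (_ || _); apply/idP/idP; lia.
Qed.

Lemma infix_nseq_nseq a j : infix (nseq a false) (nseq j false) = (a <= j).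
Proof.
apply/idP/idP => [/size_infix|le_aj]; first by rewrite !size_nseq.
apply/prefixW/prefixP; exists (nseq (j - a) false).
by rewrite -nseqD subnKC.
Qed.

(** A zero block contains all shorter ones, so the lengths that occur form an initial segment. *)
Lemma leq_longest_zero_block l w :
  (l <= longest_zero_block w) = infix (nseq l false) w.
Proof.
apply/idP/idP => [le_l|inf_l].
  have inf_max : infix (nseq (longest_zero_block w) false) w.
    rewrite /longest_zero_block.
    elim/big_ind: _ => [|a b|//]; first exact: infix0s.
    by case: (leqP a b).
  by apply: infix_trans inf_max; rewrite infix_nseq_nseq.
have lt_l : l < (size w).+1 by have := size_infix inf_l; rewrite size_nseq.
exact: (@leq_bigmax_cond _ (fun k : 'I_(size w).+1 => infix (nseq k false) w)
  (fun k => k : nat) (Ordinal lt_l)).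
Qed.

Lemma longest_zero_blockP k w :
  longest_zero_block w = k <->
  infix (nseq k false) w /\ ~~ infix (nseq k.+1 false) w.
Proof. rewrite -!leq_longest_zero_block; lia. Qed.

(* The prefix of [j] zeros is the block being read when [w] starts. *)
Lemma zeros_le_of_no_block k j w :
  ~~ infix (nseq k.+1 false) (nseq j false ++ w) ->
  j + count_mem false w <= k * (count_mem true w).+1.
Proof.
elim: w j => [|[] w IH] j.
- by rewrite cats0 infix_nseq_nseq /= => ?; lia.
- rewrite infix_nseq_run negb_or => /andP[le_jk ninf].
  by have := IH 0 ninf; rewrite /=; lia.
(* The zero just read joins the pending block: [j] becomes [j.+1]. *)
- by rewrite -(cat1s false) catA -(nseqD j 1) => /IH; rewrite /= addn1 addnS.
Qed.

(* Quantifying over the zeros put in front of [w] keeps track of the first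
   block of [w] without naming it. *)
Lemma zero_block_filling k m x : x <= k * m ->
  exists w, [/\ count_mem true w = m, count_mem false w = x
    & forall j, infix (nseq k.+1 false) (nseq j false ++ w) = (k < j)].
Proof.
elim: m x => [|m IH] x le_x.
  exists [::]; split=> [//||j]; first by move: le_x => /=; lia.
  by rewrite cats0 infix_nseq_nseq.
have [|w [trw faw infw]] := IH (x - minn k x); first by lia.
(* The leading one closes the block put in front; the next block takes as many zeros as [k]
   allows. *)
exists (true :: nseq (minn k x) false ++ w).
split=> [||j] /=; rewrite ?count_cat ?count_nseq /= ?trw ?faw //; try lia.
by rewrite infix_nseq_run infw; lia.
Qed.

Lemma size_count_bool w : size w = count_mem true w + count_mem false w.
Proof.
rewrite -(count_predC (pred1 true)); congr (_ + _).
by apply: eq_count; case.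
Qed.

Lemma F_gt0 n x k :
  (0 < F n x k) = [&& k <= x, x <= n & x <= k * (n - x).+1].
Proof.
apply/card_gt0P/and3P => [[w]|[le_kx le_xn le_x]].
  rewrite inE => /andP[/eqP <- /eqP lzb].
  have szw := size_count_bool w; rewrite size_tuple in szw.
  have [inf ninf] := (longest_zero_blockP k w).1 lzb.
  have le_w := @zeros_le_of_no_block k 0 w ninf.
  have -> : n - count_mem false w = count_mem true w by lia.
  split=> //; last by rewrite -[leqRHS](size_tuple w) count_size.
  have [u [v ->]] := infixP inf.
  by rewrite !count_cat count_nseq /=; lia.
(* The first block uses [k] zeros; the other [x - k] go into the [n - x] blocks that each follow a
   one. *)
have [|w [trw faw infw]] := @zero_block_filling k (n - x) (x - k); first by lia.
have szw : size (nseq k false ++ w) == n.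
  by rewrite size_cat size_nseq size_count_bool trw faw; lia.
exists (Tuple szw); rewrite inE /= count_cat count_nseq faw /=.
apply/andP; split; first by lia.
by apply/eqP/longest_zero_blockP; rewrite infw prefix_infix; lia.
Qed.

(** Adding [n - x] to both sides of the first inequality gives [n < k.+1 * (n - x).+1]. *)
Lemma leq_mul_divn n x k : x <= n ->
  (x <= k * (n - x).+1) = (n %/ (n - x).+1 <= k).
Proof. by move=> le_xn; rewrite -[RHS]ltnS ltn_divLR // mulSn; lia. Qed.

Definition S_seq n : seq (nat * nat) :=
  [seq (x, k) | x <- iota 0 n.+1,
                k <- iota (n %/ (n - x).+1) (x.+1 - n %/ (n - x).+1)].

Lemma mem_S_seq n x k : ((x, k) \in S_seq n) = (0 < F n x k).
Proof.
rewrite F_gt0; apply/allpairsPdep/and3P.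
  move=> [x' [k' [+ + [-> ->]]]]; rewrite !mem_iota => ? ?.
  by rewrite leq_mul_divn; [split|]; lia.
move=> [le_kx le_xn]; rewrite leq_mul_divn // => le_k.
by exists x, k; rewrite !mem_iota; split=> //; lia.
Qed.

Lemma uniq_S_seq n : uniq (S_seq n).
Proof.
apply: allpairs_uniq_dep => [|x _|[x k] [x' k'] _ _ [-> ->] //]; exact: iota_uniq.
Qed.

Lemma size_S_seq n :
  size (S_seq n) + \sum_(0 <= i < n.+1) n %/ i.+1 = 'C(n + 2, 2).
Proof.
rewrite size_allpairs_dep sumnE big_map -[iota 0 n.+1]/(index_iota 0 n.+1).
(* Reversal puts [n - x] for [i], so each quotient meets the same one subtracted in the count for
   [x]. *)
rewrite [X in _ + X]big_nat_rev -big_split.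
rewrite addn2 -bin2_sum [RHS]big_nat_recl // !add0n.
apply: eq_big_nat => x /andP[_ lt_xn].
(* The subtraction is not truncated, as the quotient is at most [x.+1]. *)
rewrite /= size_iota subSS subnK // -ltnS ltn_divLR //; nia.
Qed.

Theorem theorem2p3 (n : nat) :
  finite_set (S_ n) /\
  (#|` fset_set (S_ n)|%fset%:Z
   = 'C(n + 2, 2)%:Z - (\sum_(0 <= i < n.+1) n %/ i.+1)%N%:Z)%R.
Proof.
have -> : S_ n = [set` [fset p in S_seq n]%fset]%classic.
  by apply/seteqP; split=> -[x k] /=; rewrite in_fset /= mem_S_seq.
split; first exact: finite_fset.
rewrite set_fsetK card_fseq undup_id ?uniq_S_seq // -size_S_seq.
by rewrite PoszD GRing.addrK.
Qed.
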